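(* Let $K$ be the field of Puiseux series with real exponents and complex coefficients described in the context. Let $L$ be an $(n-k)$-dimensional linear subspace of $K^n$ all of whose Plücker coordinates are non-zero. Let $M \in K^{m \times n}$, $m \geq k$, be a matrix whose rows are non-zero elements of the orthogonal complement of $L$. If the rows of $M$ form a tropical basis for $L$, then any $k$ columns of $\deg(M)$ have tropical rank $k$ (i.e. every $m\times k$ submatrix of $\deg(M)$ formed by $k$ of its columns has tropical rank $k$).
   Context: $K$ is the field of series $\sum_{a \in I} c_a x^a$ where $c_a \in \mathbb{C}$ and $I$ is a locally finite subset of $\mathbb{R}$ with a least element. Let $\mathbb{T} = \mathbb{R}\cup\{\infty\}$ with $\oplus = \min$ and $\odot = +$. The map $\deg : K \to \mathbb{T}$ sends a non-zero series to its lowest exponent and $0$ to $\infty$; it is applied entrywise to vectors and matrices. The Plücker coordinates of a $d$-dimensional subspace $L\subset K^n$ are the maximal minors of a $d\times n$ matrix with row space $L$. The orthogonal complement of $L$ is the space of linear forms $a=(a_1,\dots,a_n)\in K^n$ with $\sum a_i v_i=0$ for all $v\in L$. The tropicalization of a linear form $a_1X_1+\dots+a_nX_n$ over $K$ is the tropical linear form $\bigoplus_{i=1}^n \deg(a_i)\odot x_i$; its tropical hyperplane is the set of points $x$ with coordinates in $\mathbb{T}$ at which the minimum of $\deg(a_i)+x_i$, $1\le i\le n$, is attained at least twice (a minimum equal to $\infty$, where all terms are $\infty$, counts as attained at least twice). The tropical linear space of $L$ is the image $\deg(L)\subset\mathbb{T}^n$; equivalently, it is the intersection of the tropical hyperplanes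 of the tropicalizations of all linear forms of minimal support in the orthogonal complement of $L$. A set of linear forms is a tropical basis for $L$ if the intersection of the tropical hyperplanes of their tropicalizations equals the tropical linear space $\deg(L)$. The tropical determinant of an $r\times r$ matrix $A=[a_{ij}]$ over $\mathbb{T}$ is $\bigoplus_{\sigma\in S_r} (a_{1\sigma_1}\odot\cdots\odot a_{r\sigma_r})$. The matrix is tropically non-singular if the minimum in its tropical determinant is finite and attained by a unique permutation $\sigma\in S_r$. The tropical rank of a matrix is the largest $r$ such that it has a tropically non-singular $r\times r$ submatrix. *)

(* Defs.v *)
From HB Require Import structures.
From mathcomp Require Import all_boot all_order all_fingroup all_algebra.
From mathcomp Require Import all_classical all_reals constructive_ereal ereal.
From mathcomp Require Import complex lra.

Set Implicit Arguments.
Unset Strict Implicit.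
Unset Printing Implicit Defensive.

Import Order.TTheory GRing.Theory Num.Theory.

Local Open Scope classical_set_scope.
Local Open Scope ring_scope.

Section Series.
Context {R : realType} {F : fieldType}.
Implicit Types (f g h : R -> F) (a b c r : R).

Definition locally_finite (I : set R) :=
  forall a b, finite_set (I `&` [set x | a <= x <= b]).

Definition has_least (I : set R) := exists2 m, I m & forall a, I a -> m <= a.

(* [f] is the coefficient function of a series [\sum_(a in I) f a * x^a].     *)
Definition is_puiseux f := exists I : set R,
  [/\ locally_finite I, has_least I & forall a, f a != 0 -> I a].

(* The support of [f] meets every [(-oo, r]] in a finite set.                 *)
Definition left_finite f := forall r, exists2 s : seq R, uniq s &
  forall a, a <= r -> f a != 0 -> a \in s.

Lemma is_puiseuxP f : is_puiseux f <-> left_finite f.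
Proof.
split=> [[I [Ifin [m Im lem] sI]] r|lf].
  have /finite_seqP[s Es] := Ifin m r.
  exists (undup s); first exact: undup_uniq.
  move=> a ar fa; rewrite mem_undup.
  have : (I `&` [set x | m <= x <= r]) a.
    by split; [exact: sI|rewrite /= ar lem//; exact: sI].
  by rewrite Es.
have [s0 _ s0P] := lf 0.
pose m := \big[Order.min/0]_(a <- s0) a.
have m0 : m <= 0.
  rewrite /m; elim: s0 {s0P m} => [|x s0 IH]; first by rewrite big_nil.
  by rewrite big_cons ge_min IH orbT.
have ms a : a \in s0 -> m <= a.
  rewrite /m; elim: s0 {s0P m m0} => // x s0 IH.
  rewrite inE big_cons ge_min => /orP[/eqP->|/IH->]; rewrite ?lexx//.
  by rewrite orbT.
exists ([set a | f a != 0] `|` [set m]); split.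
- move=> a b; have [s _ sP] := lf b.
  apply: (@sub_finite_set _ _ ([set` s] `|` [set m])).
    by move=> x [[fx /andP[_ xb]|->] ]; [left; exact: sP|right].
  by rewrite finite_setU; split; [exact: finite_seq|exact: finite_set1].
- exists m; first by right.
  move=> a [fa|->//]; have [a0|/ltW a0] := leP a 0; first exact/ms/s0P.
  exact: le_trans a0.
- by move=> a fa; left.
Qed.

Lemma is_puiseux_lb f : is_puiseux f -> exists b, forall a, f a != 0 -> b <= a.
Proof. by case=> I [_ [m _ lem] sI]; exists m => a /sI/lem. Qed.

Record puiseux := Puiseux { pcoef :> R -> F; pcoefP : is_puiseux pcoef }.

HB.instance Definition _ := gen_eqMixin puiseux.
HB.instance Definition _ := gen_choiceMixin puiseux.

Lemma puiseux_ext (f g : puiseux) : pcoef f =1 pcoef g -> f = g.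
Proof.
case: f g => [f pf] [g pg] /= /funext E; rewrite E in pf *.
by rewrite (Prop_irrelevance pf pg).
Qed.

Lemma is_puiseux_monomial a (c : F) :
  is_puiseux (fun b => if b == a then c else 0).
Proof.
apply/is_puiseuxP => r; exists [:: a] => // b _.
by rewrite inE; case: ifP => // _; rewrite eqxx.
Qed.
Definition monomial a (c : F) := Puiseux (is_puiseux_monomial a c).

Lemma is_puiseux_zero : is_puiseux (fun=> 0).
Proof. by apply/is_puiseuxP => r; exists [::] => // a _; rewrite eqxx. Qed.

Lemma is_puiseux_opp f : is_puiseux f -> is_puiseux (fun a => - f a).
Proof.
move=> /is_puiseuxP lf; apply/is_puiseuxP => r; have [s us sP] := lf r.
by exists s => // a; rewrite oppr_eq0; exact: sP.
Qed.

Lemma is_puiseux_add f g :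
  is_puiseux f -> is_puiseux g -> is_puiseux (fun a => f a + g a).
Proof.
move=> /is_puiseuxP lf /is_puiseuxP lg; apply/is_puiseuxP => r.
have [s _ sP] := lf r; have [t _ tP] := lg r.
exists (undup (s ++ t)); rewrite ?undup_uniq// => a ar fga.
rewrite mem_undup mem_cat; have [fa0|fa] := eqVneq (f a) 0.
  by rewrite fa0 add0r in fga; rewrite tP ?orbT.
by rewrite sP.
Qed.

Definition pzero := Puiseux is_puiseux_zero.
Definition popp (f : puiseux) := Puiseux (is_puiseux_opp (pcoefP f)).
Definition padd (f g : puiseux) :=
  Puiseux (is_puiseux_add (pcoefP f) (pcoefP g)).

Lemma paddA : associative padd.
Proof. by move=> f g h; apply: puiseux_ext => a /=; rewrite addrA. Qed.
Lemma paddC : commutative padd.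
Proof. by move=> f g; apply: puiseux_ext => a /=; rewrite addrC. Qed.
Lemma padd0 : left_id pzero padd.
Proof. by move=> f; apply: puiseux_ext => a /=; rewrite add0r. Qed.
Lemma paddN : left_inverse pzero popp padd.
Proof. by move=> f; apply: puiseux_ext => a /=; rewrite addNr. Qed.

HB.instance Definition _ := GRing.isZmodule.Build puiseux paddA paddC padd0 paddN.

(* For Puiseux series only finitely many terms are non-zero, so the default
   value of [\sum_(_ \in _)] on infinite supports is never used.             *)
Definition conv f g c := \sum_(a \in [set: R]) f a * g (c - a).

Lemma convE f g c (s : seq R) : uniq s ->
  (forall a, f a != 0 -> g (c - a) != 0 -> a \in s) ->
  conv f g c = \sum_(a <- s) f a * g (c - a).
Proof.
move=> us sP; rewrite /conv.
rewrite -(@fsbig_widen _ _ _ _ [set` s] [set: R])//=; last first.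
  move=> a [_ as_]; apply: contrapT => /eqP; rewrite mulf_eq0 negb_or.
  by move=> /andP[fa ga]; apply: as_ => /=; exact: sP.
by rewrite -fsbig_seq.
Qed.

Lemma conv_cover f g c : is_puiseux f -> is_puiseux g ->
  exists2 s : seq R, uniq s & forall a, f a != 0 -> g (c - a) != 0 -> a \in s.
Proof.
move=> /is_puiseuxP lf /is_puiseux_lb[b bP]; have [s us sP] := lf (c - b).
by exists s => // a fa /bP ba; apply: sP => //; lra.
Qed.

Lemma convC f g : is_puiseux f -> is_puiseux g -> conv f g = conv g f.
Proof.
move=> pf pg; apply/funext => c; have [s us sP] := conv_cover c pf pg.
have usc : uniq [seq c - a | a <- s].
  by rewrite map_inj_uniq// => x y /addrI/oppr_inj.
rewrite (convE us sP) (@convE _ _ c [seq c - a | a <- s])//.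
  by rewrite big_map; apply: eq_bigr => a _; rewrite subKr mulrC.
move=> a ga fa; apply/mapP; exists (c - a); rewrite ?subKr//.
by apply: sP; rewrite ?subKr.
Qed.

Lemma conv_lb f g bf bg : is_puiseux f -> is_puiseux g ->
  (forall a, f a != 0 -> bf <= a) -> (forall a, g a != 0 -> bg <= a) ->
  forall c, conv f g c != 0 -> bf + bg <= c.
Proof.
move=> pf pg Hf Hg c; have [s us sP] := conv_cover c pf pg.
rewrite (convE us sP); apply: contraNT; rewrite -ltNge => cb.
rewrite big1 // => a _; apply/eqP; rewrite mulf_eq0.
apply/norP => -[/Hf fa /Hg ga]; lra.
Qed.

Lemma is_puiseux_conv f g :
  is_puiseux f -> is_puiseux g -> is_puiseux (conv f g).
Proof.
move=> pf pg; apply/is_puiseuxP => r.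
have [bf fP] := is_puiseux_lb pf; have [bg gP] := is_puiseux_lb pg.
have /is_puiseuxP lf := pf; have /is_puiseuxP lg := pg.
have [s us sP] := lf (r - bg); have [t ut tP] := lg (r - bf).
exists (undup [seq a + b | a <- s, b <- t]); rewrite ?undup_uniq// => c cr.
have [s' us' sP'] := conv_cover c pf pg.
rewrite (convE us' sP') mem_undup; apply: contraNT => cst.
rewrite big1// => a _; apply/eqP; rewrite mulf_eq0; apply/norP => -[fa ga].
have ba := fP _ fa; have bca := gP _ ga.
move/negP: cst; apply; apply/allpairsP; exists (a, c - a).
by split => /=; [apply: sP => //; lra|apply: tP => //; lra|rewrite addrC subrK].
Qed.

Definition pmul (f g : puiseux) :=
  Puiseux (is_puiseux_conv (pcoefP f) (pcoefP g)).
Definition pone := monomial 0 1.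

Lemma pmulC : commutative pmul.
Proof.
by move=> f g; apply: puiseux_ext => a /=; rewrite convC//; exact: pcoefP.
Qed.

Lemma pmulA : associative pmul.
Proof.
move=> f g h; rewrite [RHS]pmulC [pmul g h]pmulC.
apply: puiseux_ext => d /=.
have [[[bf fP] [bg gP]] [bh hP]] := (is_puiseux_lb (pcoefP f),
  is_puiseux_lb (pcoefP g), is_puiseux_lb (pcoefP h)).
have /is_puiseuxP/(_ (d - bg - bh))[sf usf sfP] := pcoefP f.
have /is_puiseuxP/(_ (d - bf - bg))[sh ush shP] := pcoefP h.
rewrite (@convE f _ d sf)//; last first.
  move=> a fa /(conv_lb (pcoefP _) (pcoefP _) hP gP) ?; apply: sfP => //; lra.
rewrite (@convE h _ d sh)//; last first.
  move=> a fa /(conv_lb (pcoefP _) (pcoefP _) fP gP) ?; apply: shP => //; lra.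
transitivity (\sum_(a <- sf) \sum_(c <- sh) f a * (h c * g (d - a - c))).
  apply: eq_bigr => a _; rewrite -big_distrr/=.
  have [->|fa] := eqVneq (f a) 0; first by rewrite !mul0r.
  rewrite (@convE h g _ sh)// => c hc /gP ?; apply: shP => //.
  by have := fP _ fa; lra.
rewrite exchange_big/=; apply: eq_bigr => c _.
have [->|hc] := eqVneq (h c) 0.
  by rewrite mul0r big1// => a _; rewrite mul0r mulr0.
rewrite (@convE f g _ sf)//; last first.
  by move=> a fa /gP ?; apply: sfP => //; have := hP _ hc; lra.
rewrite big_distrr; apply: eq_bigr => a _ /=.
by rewrite mulrCA addrAC.
Qed.

Lemma pcoef_monomial_mul b (c : F) (f : puiseux) a :
  pmul (monomial b c) f a = c * f (a - b).
Proof.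
rewrite /= (@convE _ _ _ [:: b])//= ?big_seq1 ?eqxx// => x.
by rewrite inE; case: ifP => //; rewrite eqxx.
Qed.

Lemma pmul1 : left_id pone pmul.
Proof.
move=> f; apply: puiseux_ext => c.
by rewrite pcoef_monomial_mul subr0 mul1r.
Qed.

Lemma pmulDl : left_distributive pmul padd.
Proof.
move=> f g h; apply: puiseux_ext => c.
have [sf _ sfP] := conv_cover c (pcoefP f) (pcoefP h).
have [sg _ sgP] := conv_cover c (pcoefP g) (pcoefP h).
pose s := undup (sf ++ sg).
have us : uniq s by exact: undup_uniq.
rewrite /= !(@convE _ _ _ s)//=; last 3 first.
- by move=> a ga ha; rewrite mem_undup mem_cat sgP ?orbT.
- by move=> a ga ha; rewrite mem_undup mem_cat sfP ?orbT.
- move=> a fga ha; rewrite mem_undup mem_cat.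
  have [fa0|fa] := eqVneq (f a) 0; last by rewrite sfP.
  by rewrite fa0 add0r in fga; rewrite sgP ?orbT.
by rewrite -big_split/=; apply: eq_bigr => a _; rewrite mulrDl.
Qed.

Lemma pone_neq0 : pone != 0.
Proof.
apply/eqP => /(congr1 (fun f : puiseux => f 0))/=; rewrite eqxx.
by apply/eqP; rewrite oner_eq0.
Qed.

HB.instance Definition _ := GRing.Zmodule_isComNzRing.Build puiseux
  pmulA pmulC pmul1 pmulDl pone_neq0.

Lemma pcoef0 a : (0 : puiseux) a = 0. Proof. by []. Qed.
Lemma pcoefN (f : puiseux) a : (- f) a = - f a. Proof. by []. Qed.
Lemma pcoefD (f g : puiseux) a : (f + g) a = f a + g a. Proof. by []. Qed.
Lemma pcoefM (f g : puiseux) a : (f * g) a = conv f g a. Proof. by []. Qed.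
Lemma pcoef1 a : (1 : puiseux) a = (a == 0)%:R.
Proof. by rewrite /=; case: eqP. Qed.
Lemma pcoef_sum (n : nat) (f : 'I_n -> puiseux) a :
  (\sum_i f i) a = \sum_i f i a.
Proof. by elim/big_rec2 : _ => // i x y _ <-. Qed.

Lemma puiseux_least (f : puiseux) : f != 0 ->
  exists2 m, f m != 0 & forall a, f a != 0 -> m <= a.
Proof.
move=> f0; have [b fb] : exists b, f b != 0.
  apply: contrapT => /forallNP H; move/eqP: f0; apply.
  by apply: puiseux_ext => a; apply/eqP; apply: contrapT => /negP/(H a).
have /is_puiseuxP/(_ b)[s _ sP] := pcoefP f.
pose t := [seq a <- s | f a != 0].
pose m := \big[Order.min/b]_(a <- t) a.
have fm : f m != 0.
  rewrite /m big_seq; elim/big_ind : _ => // [x y fx fy|x].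
    by rewrite minElt; case: ifP.
  by rewrite mem_filter => /andP[].
have mb : m <= b.
  rewrite /m; elim: t {m fm} => [|x t IH]; first by rewrite big_nil.
  by rewrite big_cons ge_min IH orbT.
have mt a : a \in t -> m <= a.
  rewrite /m; elim: t {m mb fm} => // x t IH.
  by rewrite inE big_cons ge_min => /orP[/eqP->|/IH->]; rewrite ?lexx ?orbT.
exists m => // a fa; have [ab|/ltW ba] := leP a b; last exact: le_trans ba.
by apply: mt; rewrite mem_filter fa sP.
Qed.

Lemma unit_puiseux1B (u : puiseux) : (forall a, a <= 0 -> u a = 0) ->
  exists g : puiseux, (1 - u) * g = 1.
Proof.
move=> u0.
have [e e0 ue] : exists2 e, 0 < e & forall a, u a != 0 -> e <= a.
  have [->|/puiseux_least[m um mP]] := eqVneq u 0.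
    by exists 1 => // a; rewrite pcoef0 eqxx.
  by exists m => //; rewrite ltNge; apply: contra um => /u0->.
have uX n a : (u ^+ n) a != 0 -> n%:R * e <= a.
  elim: n a => [|n IH] a.
    rewrite expr0 pcoef1 mul0r; have [->|] := eqVneq a 0; first by rewrite lexx.
    by rewrite eqxx.
  rewrite exprS pcoefM => /(conv_lb (pcoefP _) (pcoefP _) ue IH).
  by rewrite -natr1 mulrDl mul1r addrC.
pose P n : puiseux := \sum_(i < n) u ^+ i.
have PE n n' a : a < n%:R * e -> (n <= n')%N -> P n' a = P n a.
  move=> an nn'; rewrite !pcoef_sum -!(big_mkord xpredT (fun i => (u ^+ i) a)).
  rewrite (big_cat_nat (leq0n n) nn')//= [X in _ + X]big1_seq ?addr0// => i.
  rewrite mem_index_iota => /= /andP[ni _]; apply/eqP.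
  apply: contraLR an => /uX ia; rewrite -leNgt (le_trans _ ia)//.
  by rewrite ler_wpM2r ?ler_nat// ltW.
pose N a := Num.bound (`|a| / e).
have NP a : a < (N a)%:R * e.
  rewrite -ltr_pdivrMr//; apply: le_lt_trans (archi_boundP _).
    by rewrite ler_pM2r ?invr_gt0// ler_norm.
  by rewrite divr_ge0// ltW.
pose g a := P (N a) a.
have gE a r : a <= r -> g a = P (N r) a.
  move=> ar; rewrite /g; have [le|/ltnW le] := leqP (N a) (N r).
    exact/esym/PE.
  by apply: PE => //; rewrite (le_lt_trans ar).
have pg : is_puiseux g.
  apply/is_puiseuxP => r; have /is_puiseuxP/(_ r)[s us sP] := pcoefP (P (N r)).
  by exists s => // a ar; rewrite (gE _ _ ar); exact: sP.
exists (Puiseux pg); apply: puiseux_ext => r.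
transitivity (((1 - u) * P (N r)) r).
  rewrite !pcoefM; apply: eq_fsbigr => a _.
  have [a0|a0] := leP 0 a; first by rewrite [pcoef (Puiseux _) _](@gE _ r)//; lra.
  by rewrite pcoefD pcoefN pcoef1 u0 ?ltW// lt_eqF// subr0 !mul0r.
transitivity ((1 - u ^+ N r) r).
  by congr (pcoef _ r); rewrite -[RHS]opprB subrX1 -mulNr opprB.
rewrite pcoefD pcoefN; have [->|/uX] := eqVneq ((u ^+ N r) r) 0.
  by rewrite subr0.
by rewrite leNgt NP.
Qed.

Lemma puiseux_inv_ex (f : puiseux) : f != 0 -> exists g : puiseux, g * f = 1.
Proof.
move=> /puiseux_least[m fm mP]; pose X : puiseux := monomial (- m) (f m)^-1.
have [|g gP] := @unit_puiseux1B (1 - X * f).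
  move=> a; rewrite pcoefD pcoefN pcoef1 [(X * f) a]pcoef_monomial_mul opprK.
  rewrite le_eqVlt => /orP[/eqP->|a0].
    by rewrite eqxx add0r mulVf// subrr.
  have [->|/mP] := eqVneq (f (a + m)) 0; first by rewrite mulr0 subr0 lt_eqF.
  by move=> am; exfalso; lra.
by exists (g * X); rewrite -mulrA mulrC -[RHS]gP subKr.
Qed.

Definition pinv (f : puiseux) : puiseux := xget 0 [set g | g * f = 1].

Lemma pmulVf (f : puiseux) : f != 0 -> pinv f * f = 1.
Proof. by move=> /puiseux_inv_ex; rewrite /pinv => /xgetPex; apply. Qed.

Lemma pinv0 : pinv 0 = 0.
Proof.
by apply: xgetPN => g; rewrite /= mulr0 => /esym/eqP; rewrite oner_eq0.
Qed.

HB.instance Definition _ := GRing.ComNzRing_isField.Build puiseux pmulVf pinv0.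

Definition deg (f : puiseux) : \bar R := xget +oo%E
  [set e | exists2 a, e = a%:E & f a != 0 /\ forall b, f b != 0 -> a <= b].

Lemma deg0 : deg 0 = +oo%E.
Proof. by apply: xgetPN => e [a _ []]; rewrite eqxx. Qed.

Lemma degE (f : puiseux) a :
  f a != 0 -> (forall b, f b != 0 -> a <= b) -> deg f = a%:E.
Proof.
move=> fa aP; apply: xget_unique; first by exists a.
move=> _ [b -> [fb bP]]; congr EFin; apply/le_anti.
by rewrite aP// bP.
Qed.

Lemma deg_eqy (f : puiseux) : (deg f == +oo%E) = (f == 0).
Proof.
have [->|/puiseux_least[a fa aP]] := eqVneq f 0; first by rewrite deg0 eqxx.
by rewrite (degE fa aP).
Qed.

End Series.
Arguments puiseux : clear implicits.

Section Tropical.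
Context {R : realType}.

(* [\bar R] plays the role of the tropical semiring, [mine] and [adde] being
   its operations; [-oo] has to be excluded from the coordinates of points.   *)
Definition trop_space n : set 'rV[\bar R]_n :=
  [set x | forall i, x ord0 i != -oo%E].

Definition trop_form n (a x : 'rV[\bar R]_n) : \bar R :=
  \big[Order.min/+oo%E]_i (a ord0 i + x ord0 i)%E.

Definition trop_hyperplane n (a : 'rV[\bar R]_n) : set 'rV[\bar R]_n :=
  [set x | trop_space x /\
    (trop_form a x = +oo%E \/
     exists i j, [/\ i != j, (a ord0 i + x ord0 i)%E = trop_form a x &
                     (a ord0 j + x ord0 j)%E = trop_form a x])].

Definition trop_weight r (A : 'M[\bar R]_r) (s : {perm 'I_r}) : \bar R :=
  (\sum_i A i (s i))%E.

Definition trop_det r (A : 'M[\bar R]_r) : \bar R :=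
  \big[Order.min/+oo%E]_(s : {perm 'I_r}) trop_weight A s.

Definition trop_nonsingular r (A : 'M[\bar R]_r) :=
  trop_det A \is a fin_num /\ exists! s, trop_weight A s = trop_det A.

(* The order in which rows and columns are selected does not matter.          *)
Definition has_trop_nonsingular_submx m n (A : 'M[\bar R]_(m, n)) r :=
  exists (f : 'I_r -> 'I_m) (g : 'I_r -> 'I_n),
    [/\ injective f, injective g & trop_nonsingular (mxsub f g A)].

Definition trop_rank m n (A : 'M[\bar R]_(m, n)) : nat :=
  \max_(r < (minn m n).+1 | `[< has_trop_nonsingular_submx A r >]) r.

Lemma trop_rankP m n (A : 'M[\bar R]_(m, n)) :
  has_trop_nonsingular_submx A (trop_rank A) /\
  forall r, has_trop_nonsingular_submx A r -> (r <= trop_rank A)%N.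
Proof.
split.
  have A0 : has_trop_nonsingular_submx A 0.
    have f0 k : 'I_0 -> 'I_k by case.
    exists (f0 m), (f0 n); split; [by case|by case|].
    have w0 s : trop_weight (mxsub (f0 m) (f0 n) A) s = 0%E.
      by rewrite /trop_weight big_ord0.
    have E (s t : {perm 'I_0}) : s = t by apply/permP => -[].
    have d0 : trop_det (mxsub (f0 m) (f0 n) A) = 0%E.
      rewrite /trop_det (big_pred1 1%g) ?w0// => t.
      by rewrite /= [t](E _ 1%g) eqxx.
    split; first by rewrite d0.
    by exists 1%g; split => [|t _]; [rewrite d0|exact: E].
  rewrite /trop_rank.
  elim/big_ind : _ => // [r s Hr Hs|r /asboolP//].
  by rewrite /maxn; case: ifP.
move=> r Ar; have [f [g [fi gi _]]] := Ar.
have rmn : (r < (minn m n).+1)%N.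
  have := leq_card _ fi; have := leq_card _ gi.
  by rewrite !card_ord ltnS leq_min => -> ->.
by apply: (@leq_bigmax_cond _ _ _ (Ordinal rmn)); exact/asboolP.
Qed.

End Tropical.

Section LinearSpace.
Context {R : realType} {F : fieldType}.
Local Notation K := (puiseux R F).

Definition orthogonal_complement n (L : {vspace 'rV[K]_n}) : set 'rV[K]_n :=
  [set a | forall v, v \in L -> \sum_i a ord0 i * v ord0 i = 0].

(* [B] ranges over the matrices with row space [L]; the selections [f] also
   include permuted ones, which changes a maximal minor by a sign only.       *)
Definition nonzero_plucker n (L : {vspace 'rV[K]_n}) :=
  forall B : 'M[K]_(\dim L, n), (forall v, (v \in L) = (v <= B)%MS) ->
  forall f : 'I_(\dim L) -> 'I_n, injective f -> \det (colsub f B) != 0.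

Definition trop_linear_space n (L : {vspace 'rV[K]_n}) : set 'rV[\bar R]_n :=
  [set map_mx deg v | v in [set` L]].

(* [trop_space] only matters in the intersection when [S] is empty.           *)
Definition trop_basis n (S : set 'rV[K]_n) (L : {vspace 'rV[K]_n}) :=
  @trop_space R n `&` \bigcap_(a in S) trop_hyperplane (map_mx deg a) =
  trop_linear_space L.

End LinearSpace.

(* Main.v *)
Require Import Defs.
From HB Require Import structures.
From mathcomp Require Import all_boot all_order all_fingroup all_algebra.
From mathcomp Require Import all_classical all_reals constructive_ereal ereal.
From mathcomp Require Import complex lra.

Set Implicit Arguments.
Unset Strict Implicit.
Unset Printing Implicit Defensive.

Import Order.TTheory GRing.Theory Num.Theory.

Local Open Scope classical_set_scope.
Local Open Scope ring_scope.

(** The theorem reduces to a purely tropical fact: an m x k matrix A over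
    R and +oo either has tropical rank k, or its columns are tropically
    dependent, which means that some x, not entirely infinite, makes the
    minimum of A i j + x j over j attained twice, or infinite, in every row i.

    Why this suffices: let A consist of k columns of deg M and suppose that x
    witnesses their dependence. Extended by +oo on the other n - k coordinates,
    x lies on the tropical hyperplanes of all rows of M, so the tropical basis
    hypothesis gives x = deg v with v in L. Then v is a non-zero vector of L
    vanishing on n - k = dim L coordinates, which a non-zero Pluecker
    coordinate on these coordinates forbids ([plucker_support]).

    Why the tropical fact holds: view dependence as a system of conditions
    indexed by pairs (i, j), the condition (i, j) being that column j is not
    the only place where row i attains a finite minimum. If x and y are equal
    and finite at j, y satisfying (i, j) and x satisfying (i', j), then their
    minimum satisfies both. Hence a minimal unsolvable set of conditions has at most one
    row for each column ([minimal_unsolvable_row]). It also has at least one,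
    because a point finite at a single coordinate j satisfies the conditions of
    all the other columns. So an unsolvable system contains one already
    unsolvable of the form (sg j, j), j ranging over the columns
    ([unsolvable_selection]).

    Let B be the square matrix whose row j is row sg j of A. If a permutation
    s other than the identity had weight at most that of the diagonal, then
    along some non-trivial cycle of s the total of B j (s j) - B j j would be at
    most 0, and a potential x along this cycle would satisfy
    B j (s j) + x (s j) <= B j j + x j, solving the system
    ([nonpositive_cycle_potential], [diagonal_unique_min]). So the diagonal is
    the unique minimum in the tropical determinant of B. In particular no two
    rows of B come from the same row of A, as exchanging them would give a
    second minimum, and B is a non-singular submatrix of A. *)

(** * Tropical linear systems *)

Section TropicalIndependence.
Context {R : realType}.

Definition sole_min k (w : 'I_k -> \bar R) (j : 'I_k) :=
  (w j < +oo)%E /\ forall l, l != j -> (w j < w l)%E.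

(** The terms, indexed by the column [l], of the tropical linear form in row
    [i] of [A] at the point [x]. *)
Definition terms m k (A : 'M[\bar R]_(m, k)) (x : 'rV[\bar R]_k) i l : \bar R :=
  (A i l + x ord0 l)%E.

Definition proper_point k (x : 'rV[\bar R]_k) :=
  trop_space x /\ exists j, x ord0 j != +oo%E.

(** The pair [(i, j)] stands for the condition that column [j] is not the only
    one to attain a finite minimum in row [i]. Each such condition is a tropical
    half-space, stable under minima and translations, unlike the hyperplane of
    row [i], which is their intersection over [j]. *)
Definition unsolvable m k (A : 'M[\bar R]_(m, k)) (P : {set 'I_m * 'I_k}) :=
  forall x, proper_point x ->
    exists2 p, p \in P & sole_min (terms A x p.1) p.2.

Lemma sole_min_finite m k (A : 'M[\bar R]_(m, k)) (x : 'rV_k) i j :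
  A i j != -oo%E -> trop_space x -> sole_min (terms A x i) j ->
  x ord0 j \is a fin_num.
Proof.
rewrite /terms => Aij /(_ j) xj [+ _]; rewrite fin_numE xj /=.
by move: Aij; case: (A i j) => [r| |]; case: (x ord0 j).
Qed.

(** Violated conditions pass upwards: raising the coordinates other than [j]
    only makes the minimum at [j] more isolated. *)
Lemma sole_min_le m k (A : 'M[\bar R]_(m, k)) (x z : 'rV_k) i j :
  (forall l, z ord0 l <= x ord0 l)%E -> z ord0 j = x ord0 j ->
  sole_min (terms A z i) j -> sole_min (terms A x i) j.
Proof.
rewrite /sole_min /terms => zx -> [fin lt]; split=> // l /lt /lt_le_trans.
by apply; rewrite leeD2l.
Qed.

Lemma sole_min_shift m k (A : 'M[\bar R]_(m, k)) (x : 'rV_k) (r : R) i j :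
  sole_min (terms A (\row_l (x ord0 l + r%:E)%E) i) j ->
  sole_min (terms A x i) j.
Proof.
rewrite /sole_min /terms !mxE !addeA => -[fin lt]; split.
  by move: fin; rewrite !ltey; apply: contra_neq => ->; rewrite addye.
by move=> l /lt; rewrite mxE addeA lteD2rE.
Qed.

Lemma hyperplane_sole_min m k (A : 'M[\bar R]_(m, k)) (x : 'rV_k) i :
  trop_space x -> (forall j, ~ sole_min (terms A x i) j) ->
  trop_hyperplane (row i A) x.
Proof.
move=> tx nosole; split=> //; set v := trop_form _ _.
have vE : v = \big[Order.min/+oo%E]_j terms A x i j.
  by apply: eq_bigr => j _; rewrite !mxE.
have vle l : (v <= terms A x i l)%E by rewrite vE bigmin_le_cond.
have [vy|[j vj]] : v = +oo%E \/ exists j, v = terms A x i j.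
  rewrite vE; elim/big_ind: _ => [|p q pP qP|j _]; [by left| |by right; exists j].
  by rewrite minElt; case: ifP.
  by left.
have [vy|vfin] := eqVneq v +oo%E; [by left|right].
have [l lj ljv] : exists2 l, l != j & (terms A x i l <= v)%E.
  apply: contrapT => none; apply: (nosole j); split; first by rewrite -vj ltey.
  move=> l lj; rewrite -vj ltNge; apply/negP => lv; apply: none.
  by exists l.
exists j, l; rewrite eq_sym lj !mxE; split=> //.
by apply/le_anti/andP; split => //; exact: vle.
Qed.

(** By minimality, some [x] violates only the condition [(i, j)] of [P], and
    some [y] only [(i', j)]. A point is finite at the column of a condition that
    it violates, so both can be translated to vanish at [j]. Their minimum then
    violates no condition of [P], unless [i = i']. *)
Lemma minimal_unsolvable_row m k (A : 'M[\bar R]_(m, k))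
    (P : {set 'I_m * 'I_k}) i i' j :
  (forall i j, A i j != -oo%E) ->
  unsolvable A P -> (forall Q : {set _}, Q \proper P -> ~ unsolvable A Q) ->
  (i, j) \in P -> (i', j) \in P -> i = i'.
Proof.
move=> Any unsP minP Pi Pi'; apply/eqP/negP => ii'.
have key h : (h, j) \in P -> exists2 x, proper_point x /\ x ord0 j = 0%E &
    forall p, p \in P -> sole_min (terms A x p.1) p.2 -> p = (h, j).
  move=> Ph; have /minP : P :\ (h, j) \proper P by rewrite properD1.
  move=> /existsNP[x /not_implyP[px Px]].
  have xP p : p \in P -> sole_min (terms A x p.1) p.2 -> p = (h, j).
    move=> pP xp; apply/eqP/negP => ph; apply: Px; exists p => //.
    by rewrite !inE pP andbT; apply/negP.
  have [p pP xp] := unsP _ px; have E := xP _ pP xp; subst p.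
  have xj := sole_min_finite (Any _ _) px.1 xp; rewrite /= in xj.
  exists (\row_l (x ord0 l + (- fine (x ord0 j))%:E)%E).
    split; last by rewrite mxE -{1}(fineK xj) -EFinD subrr.
    split=> [l|]; last by exists j; rewrite mxE -{1}(fineK xj) -EFinD.
    by rewrite mxE; have := px.1 l; case: (x ord0 l).
  by move=> q qP /sole_min_shift; exact: xP.
have [x [px xj] xP] := key _ Pi; have [y [py yj] yP] := key _ Pi'.
pose z : 'rV[\bar R]_k := \row_l Order.min (x ord0 l) (y ord0 l).
have zx l : (z ord0 l <= x ord0 l)%E by rewrite mxE ge_min lexx.
have zy l : (z ord0 l <= y ord0 l)%E by rewrite mxE ge_min lexx orbT.
have zj : z ord0 j = 0%E by rewrite mxE xj yj minxx.
have pz : proper_point z.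
  split=> [l|]; last by exists j; rewrite zj.
  by rewrite mxE minElt; case: ifP => _; [exact: px.1|exact: py.1].
(* [z] agrees with [x] or [y] at the column of the condition it violates. *)
have [p pP zp] := unsP _ pz.
have [zp2|zp2] : z ord0 p.2 = x ord0 p.2 \/ z ord0 p.2 = y ord0 p.2.
- by rewrite mxE minElt; case: ifP; [left|right].
- have E := xP _ pP (sole_min_le zx zp2 zp); subst p.
  have : (i, j) = (i', j).
    by apply: yP => //; apply: sole_min_le zp; rewrite //= zj.
  by case=> E; rewrite E eqxx in ii'.
- have E := yP _ pP (sole_min_le zy zp2 zp); subst p.
  have : (i', j) = (i, j).
    by apply: xP => //; apply: sole_min_le zp; rewrite //= zj.
  by case=> E; rewrite E eqxx in ii'.
Qed.

(** The tropical unit vector, 0 and +oo being the tropical one and zero. *)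
Definition unit_point k (j : 'I_k) : 'rV[\bar R]_k :=
  \row_l (if l == j then 0%E else +oo%E).

Lemma proper_unit_point k (j : 'I_k) : proper_point (unit_point j).
Proof. by split=> [l|]; [|exists j]; rewrite mxE ?eqxx//; case: ifP. Qed.

Lemma unit_point_sole_min m k (A : 'M[\bar R]_(m, k)) i j l :
  (forall i j, A i j != -oo%E) ->
  sole_min (terms A (unit_point j) i) l -> l = j /\ (A i l < +oo)%E.
Proof.
move=> Any Al; have := sole_min_finite (Any _ _) (proper_unit_point j).1 Al.
have [+ _] := Al; rewrite /terms !mxE.
by case: eqP => // -> + _; rewrite adde0.
Qed.

(** Every column occurs in a minimal unsolvable set, because the unit point at
    [j] can only violate conditions of column [j]; it occurs once by
    [minimal_unsolvable_row]. *)
Lemma unsolvable_selection m k (A : 'M[\bar R]_(m, k)) :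
  (forall i j, A i j != -oo%E) -> unsolvable A [set: 'I_m * 'I_k]%SET ->
  exists sg : 'I_k -> 'I_m, forall x, proper_point x ->
    exists j, sole_min (terms A x (sg j)) j.
Proof.
move=> Any unsT.
have [|P /minsetP[/asboolP unsP minP] _] :=
  @minset_exists _ (fun P => `[< unsolvable A P >]) [set: 'I_m * 'I_k]%SET.
  exact/asboolP.
have col j : exists i, (i, j) \in P.
  have [[i l] pP /(unit_point_sole_min Any)[/= E _]] :=
    unsP _ (proper_unit_point j).
  by exists i; rewrite -E.
have [sg sgP] := fin_all_exists col.
exists sg => x /unsP[[i j] pP xp]; exists j.
suff -> : sg j = i by [].
apply: (minimal_unsolvable_row Any unsP _ (sgP j) pP).
move=> Q /properP[QP [q qP qQ]] /asboolP uQ; move: qQ.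
by rewrite (minP _ uQ QP) qP.
Qed.

(** * Uniqueness of the optimal permutation *)

(** Cycles are avoided by summing over the whole order [N] of [s]: with
    [S t j] the cost of the first [t] steps from [j], [S N] is constant along
    the cycles of [s] and sums to [N] times the total cost, so it is nonpositive
    at some non-fixed point. The potential [x] is the average of the [S t] over
    [t < N]: since [S t.+1 j = c j + S t (s j)], one step changes it by [c j] up
    to the boundary term [S N j / N], whose sign is favourable on [Z]. *)
Lemma nonpositive_cycle_potential k (s : {perm 'I_k}) (c : 'I_k -> R) :
  s != 1%g -> (forall j, s j = j -> c j = 0) -> \sum_j c j <= 0 ->
  exists (Z : {set 'I_k}) (x : 'I_k -> R), [/\ Z != finset.set0,
    forall j, j \in Z -> s j \in Z /\ s j != j &
    forall j, j \in Z -> c j + x (s j) <= x j].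
Proof.
move=> s1 cfix csum; set N := #[s]%g.
pose S t j := \sum_(u < t) c ((s ^+ u)%g j).
have SS t j : S t.+1 j = c j + S t (s j).
  rewrite /S big_ord_recl expg0 perm1; congr (_ + _).
  by apply: eq_bigr => u _; rewrite expgS permM.
have SN j : S N (s j) = S N j.
  apply: (@addrI _ (c j)); rewrite -SS /S big_ord_recr /= expg_order perm1.
  by rewrite addrC.
have sumS t : \sum_j S t j = (\sum_j c j) *+ t.
  rewrite /S exchange_big /= (eq_bigr (fun=> \sum_j c j)) ?sumr_const ?card_ord//.
  by move=> u _; rewrite [RHS](reindex_perm (s ^+ u)%g).
have N0 : (0 < N)%N by exact: order_gt0.
pose x j := (\sum_(t < N) S t j) / N%:R.
exists [set j | (s j != j) && (S N j <= 0)]%SET, x; split.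
- apply/negP => /eqP Z0.
  have pos j : s j != j -> 0 < S N j.
    move=> sj; rewrite ltNge; apply/negP => Sj.
    by have := finset.in_set0 j; rewrite -Z0 inE sj Sj.
  have [j0 sj0] : exists j, s j != j.
    apply: contrapT => /forallNP H; move/negP: s1; apply; apply/eqP/permP => j.
    by rewrite perm1; apply/eqP; apply: contrapT => /negP/(H j).
  have : 0 < \sum_j S N j.
    rewrite (bigD1 j0)//=; apply: ltr_wpDr; last exact: pos.
    apply: sumr_ge0 => j _; have [sj|/pos/ltW//] := eqVneq (s j) j.
    rewrite /S big1// => u _; have -> : (s ^+ u)%g j = j; last exact: cfix.
    by elim: (val u) => [|v IH]; rewrite ?perm1// expgS permM sj.
  by rewrite sumS ltNge mulrn_wle0.
- move=> j; rewrite !inE => /andP[sj Sj]; rewrite SN Sj andbT sj; split=> //.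
  by apply: contra sj => /eqP/perm_inj->.
- move=> j; rewrite inE => /andP[_ Sj].
  rewrite /x ler_pdivlMr ?ltr0n// mulrDl divfK ?pnatr_eq0 -?lt0n//.
  have -> : c j * N%:R + \sum_(t < N) S t (s j) = \sum_(t < N) S t.+1 j.
    under [RHS]eq_bigr do rewrite SS.
    by rewrite big_split /= sumr_const card_ord mulr_natr.
  have := big_ord_recr N (fun t : 'I_N.+1 => S t j) (op := +%R).
  rewrite big_ord_recl /= {1}/S big_ord0 add0r => ->.
  by rewrite gerDl.
Qed.

(** A cheaper or equal permutation [s] would give, through
    [nonpositive_cycle_potential], a point whose finite coordinates [j] lie on
    non-trivial cycles of [s], and at which the term in column [s j] of row [j]
    of [B] is at most the diagonal one, so that [j] is not a sole minimum. *)
Lemma diagonal_unique_min k (B : 'M[\bar R]_k) :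
  (forall i j, B i j != -oo%E) ->
  (forall x, proper_point x -> exists j, sole_min (terms B x j) j) ->
  trop_weight B 1%g \is a fin_num /\
  forall s : {perm 'I_k}, s != 1%g -> (trop_weight B 1%g < trop_weight B s)%E.
Proof.
move=> Bny unsB.
have diag j : B j j \is a fin_num.
  have [i /(unit_point_sole_min Bny)[ij]] := unsB _ (proper_unit_point j).
  by rewrite ij fin_numE Bny ltey.
split=> [|s s1].
  by rewrite /trop_weight; apply/sum_fin_numP => j _ _; rewrite perm1.
rewrite ltNge; apply/negP => sle1.
have wE (t : {perm 'I_k}) : (forall j, B j (t j) \is a fin_num) ->
    trop_weight B t = (\sum_j fine (B j (t j)))%:E.
  by move=> tfin; rewrite -sumEFin; apply: eq_bigr => j _; rewrite fineK.
have w1 : trop_weight B 1%g = (\sum_j fine (B j j))%:E.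
  by rewrite wE => [|j]; [congr EFin; apply: eq_bigr => j _|]; rewrite perm1.
have sfin j : B j (s j) \is a fin_num.
  apply/negP => /negP sj; move: sle1; rewrite w1.
  suff -> : trop_weight B s = +oo%E by [].
  rewrite /trop_weight (bigD1 j)//=.
  have -> : B j (s j) = +oo%E by move: sj (Bny j (s j)); case: (B j (s j)).
  (* The remaining sum is not -oo, hence is absorbed by the infinite entry. *)
  rewrite addye//; elim/big_ind: _ => // x y.
  by case: x; case: y.
have [||Z [x [/set0Pn[z zZ] sZ xZ]]] :=
    @nonpositive_cycle_potential _ s
      (fun j => fine (B j (s j)) - fine (B j j)) s1.
- by move=> j ->; rewrite subrr.
- by move: sle1; rewrite w1 wE// lee_fin sumrB subr_le0.
pose p : 'rV[\bar R]_k := \row_j (if j \in Z then (x j)%:E else +oo%E).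
have pp : proper_point p.
  by split=> [j|]; [|exists z]; rewrite mxE ?zZ//; case: ifP.
have [j Bj] := unsB _ pp.
have := sole_min_finite (Bny _ _) pp.1 Bj; rewrite mxE.
case: ifP => // jZ _; have [sjZ sj] := sZ _ jZ.
have [_ /(_ _ sj)] := Bj; rewrite /terms !mxE jZ sjZ.
rewrite -(fineK (diag j)) -(fineK (sfin j)) -!EFinD lte_fin => lt.
by have := xZ _ jZ; lra.
Qed.

(** One half of the equality of tropical rank and tropical column rank, for
    full column rank. *)
Lemma trop_rank_unsolvable m k (A : 'M[\bar R]_(m, k)) :
  (forall i j, A i j != -oo%E) -> unsolvable A [set: 'I_m * 'I_k]%SET ->
  trop_rank A = k.
Proof.
move=> Any unsA; have [[f [g [_ ginj _]]] maxr] := trop_rankP A.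
apply/eqP; rewrite eqn_leq; apply/andP; split.
  by have := leq_card _ ginj; rewrite !card_ord.
apply: maxr; have [sg sgP] := unsolvable_selection Any unsA.
pose B := mxsub sg id A.
have [||fin1 min1] := @diagonal_unique_min _ B.
- by move=> i j; rewrite mxE.
- move=> x /sgP[j [fin lt]]; exists j; rewrite /sole_min /terms mxE.
  by split=> // l lj; rewrite mxE; exact: lt.
have det1 : trop_det B = trop_weight B 1%g.
  apply/le_anti/andP; split; first exact: bigmin_le.
  apply/bigmin_geP; split=> [|s _]; first by rewrite leey.
  by have [->|/min1/ltW] := eqVneq s 1%g.
exists sg, id; split=> //; last first.
  split; first by rewrite det1.
  exists 1%g; split=> [|s]; first by rewrite det1.
  rewrite det1; have [->//|/min1/lt_eqF + /eqP] := eqVneq s 1%g.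
  by rewrite eq_sym => ->.
(* Equal rows i and j of [B] would make the transposition as cheap as 1. *)
move=> i j sgij; apply/eqP/negP => /negP ij.
have /min1 : tperm i j != 1%g.
  apply: contra_neq ij => /(congr1 (fun s : {perm 'I_k} => s i)).
  by rewrite tpermL perm1.
suff -> : trop_weight B (tperm i j) = trop_weight B 1%g by rewrite ltxx.
rewrite /trop_weight (reindex_inj (@perm_inj _ (tperm i j)))/=.
apply: eq_bigr => l _; rewrite tpermK perm1 !mxE; congr (A _ _).
by case: tpermP => // ->.
Qed.

End TropicalIndependence.

(** * Linear spaces with non-zero Pluecker coordinates *)

Lemma deg_neqNy (R : realType) (F : fieldType) (f : puiseux R F) :
  deg f != -oo%E.
Proof.
have [->|/puiseux_least[a fa aP]] := eqVneq f 0; first by rewrite deg0.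
by rewrite (degE fa aP).
Qed.

(** The complement of [f] has exactly [\dim L] coordinates, and the minor of a
    basis matrix of [L] on them is invertible, so a vector of [L] is determined
    by these coordinates. *)
Lemma plucker_support (R : realType) (F : fieldType) (n k : nat)
    (L : {vspace 'rV[puiseux R F]_n}) (f : 'I_k -> 'I_n) (v : 'rV_n) :
  \dim L = (n - k)%N -> nonzero_plucker L -> injective f ->
  v \in L -> (forall i, i \notin codom f -> v ord0 i = 0) -> v = 0.
Proof.
move=> dimL pluckerL injf vL v0.
have cardC : \dim L = #|[predC codom f]|.
  rewrite dimL -(addKn #|codom f| #|_|) cardC card_ord.
  by rewrite (card_codom injf) card_ord.
pose g (i : 'I_(\dim L)) : 'I_n := enum_val (cast_ord cardC i).
have injg : injective g by move=> i j /enum_val_inj/cast_ord_inj.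
pose B : 'M_(\dim L, n) := \matrix_i (vbasis L)`_i.
have memB u : (u \in L) = (u <= B)%MS.
  apply/idP/submxP => [/coord_vbasis ->|[D ->]].
    exists (\row_i coord (vbasis L) i u); rewrite mulmx_sum_row.
    by apply: eq_bigr => i _; rewrite mxE rowK.
  rewrite mulmx_sum_row; apply: memv_suml => i _.
  by rewrite memvZ// rowK vbasis_mem// mem_nth// size_tuple.
have := vL; rewrite memB => /submxP[D vE].
suff D0 : D = 0 by rewrite vE D0 mul0mx.
have detB := pluckerL B memB g injg.
have : D *m colsub g B = 0.
  rewrite mulmx_colsub -vE; apply/rowP => i; rewrite !mxE v0//.
  exact: (enum_valP (cast_ord cardC i)).
move=> /(congr1 (mulmxr (invmx (colsub g B)))) /=.
by rewrite mul0mx mulmxK// unitmxE unitfE.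
Qed.

(** * The tropical rank of a tropical basis *)

Theorem theorem12 (R : realType) (n k m : nat)
    (L : {vspace 'rV[puiseux R R[i]]_n}) (M : 'M[puiseux R R[i]]_(m, n))
    (le_kn : (k <= n)%N) (dimL : \dim L = (n - k)%N)
    (pluckerL : nonzero_plucker L)
    (le_km : (k <= m)%N)
    (rowM : forall i, row i M != 0 /\ orthogonal_complement L (row i M))
    (basisM : trop_basis [set row i M | i in [set: 'I_m]] L) :
  forall f : 'I_k -> 'I_n, injective f ->
    trop_rank (colsub f (map_mx deg M)) = k.
Proof.
move=> f injf; pose A := map_mx deg M.
have Any i j : A i j != -oo%E by rewrite mxE deg_neqNy.
apply: trop_rank_unsolvable => [i j|]; first by rewrite mxE.
apply: contrapT => /existsNP[y /not_implyP[[ty [j0 yj0]] ysol]].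
pose x : 'rV[\bar R]_n :=
  \row_l (if [pick j | f j == l] is Some j then y ord0 j else +oo%E).
have xf j : x ord0 (f j) = y ord0 j.
  by rewrite mxE; case: pickP => [j' /eqP/injf->//|/(_ j)]; rewrite eqxx.
have xC l : l \notin codom f -> x ord0 l = +oo%E.
  rewrite mxE; case: pickP => [j /eqP <-|//]; by rewrite codom_f.
have tx : trop_space x.
  move=> l; have [/codomP[j ->]|/xC->//] := boolP (l \in codom f).
  by rewrite xf ty.
have : trop_linear_space L x.
  rewrite -basisM; split=> // _ [i _ <-]; rewrite map_row.
  apply: hyperplane_sole_min => // l Al; apply: ysol.
  have xl := sole_min_finite (Any _ _) tx Al.
  have [/codomP[j lE]|/xC xly] := boolP (l \in codom f); last first.
    by rewrite xly in xl.
  subst l; exists (i, j); first by rewrite inE.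
  have AyE h : terms (colsub f A) y i h = terms A x i (f h).
    by rewrite /terms xf mxE.
  case: Al => fin lt; rewrite /= /sole_min AyE; split=> // h hj.
  by rewrite AyE; apply: lt; apply: contra_neq hj => /injf.
move=> [v vL vx].
have xv l : x ord0 l = deg (v ord0 l) by rewrite -vx mxE.
have v0 : v = 0.
  apply: (plucker_support dimL pluckerL injf vL) => l /xC; rewrite xv => /eqP.
  by rewrite deg_eqy => /eqP.
by move/negP: yj0; apply; rewrite -xf xv v0 mxE deg0.
Qed.
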